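(* Let $b^*$ be the generalized Nash equilibrium of the improved sharing game described in the context. Then the sharing price at the market equilibrium is given, for every $i\in\mathcal{I}$, by $$\lambda_i^{c*}=\lambda_i^*=-\kappa^*-\sum_l\pi_{il}\tau_l^{*-}+\sum_l\pi_{il}\tau_l^{*+}.$$ Here $\lambda_i^*=\lambda_i(b^* )$ is the market clearing price, $\lambda_i^{c*}$ is the regulated price at the equilibrium, and $\kappa^*,\tau_l^{*-},\tau_l^{*+}$ are the dual variables at the optimum of the convex program (P) of the context.
   Context: Setting. There are $I\ge 2$ prosumers $i\in\mathcal{I}=\{1,\dots,I\}$, each owning $K$ resources $k\in\{1,\dots,K\}$. Prosumer $i$ has a required adjustment $D_i\in\mathbb{R}$; resource $k$ of prosumer $i$ has a cost coefficient $c_i^k>0$; $a>0$ is a constant. The prosumers sit at buses of a network (simple undirected graph) with lines $l\in\mathcal{L}=\{1,\dots,L\}$ and flow limits $F_l>0$. $\pi_{il}$ is the line flow distribution factor from the bus of prosumer $i$ to line $l$ in the DC power flow model: for a balanced vector of energy transactions $q$ ($\sum_i q_i=0$), the flow on line $l$ is $\sum_i\pi_{il}q_i$. Market clearing. Given bids $b=(b_1,\dots,b_I)\in\mathbb{R}^I$, the prices $\lambda(b)=(\lambda_1(b),\dots,\lambda_I(b))$ are the (unique) solution of $$\min_{\lambda\in\mathbb{R}^I}\ \frac1I\sum_i\lambda_i^2\quad\text{s.t.}\quad \sum_i(-a\lambda_i+b_i)=0,\quad -F_l\le\sum_i\pi_{il}(-a\lambda_i+b_i)\le F_l\ \ \forall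 l.$$ The transaction of prosumer $i$ is $q_i(b)=-a\lambda_i(b)+b_i$. Regulated price. For $p_i=(p_i^1,\dots,p_i^K)\in\mathbb{R}^K$ put $md_i=md_i(p_i):=\dfrac{2\sum_k p_i^k}{\sum_k 1/c_i^k}$. The regulated price is $$\lambda_i^c=\begin{cases}\max\{\lambda_i,\ md_i-\frac{q_i}{a(I-1)}\}, & q_i\ge 0,\\ \min\{\lambda_i,\ md_i-\frac{q_i}{a(I-1)}\}, & q_i<0.\end{cases}$$ Improved sharing game. Given the other bids $b_{-i}$, prosumer $i$ chooses $p_i\in\mathbb{R}^K$ and $b_i\in\mathbb{R}$ to minimize $$\Gamma_i=\sum_k c_i^k(p_i^k)^2+\max\left\{\lambda_i(b)q_i(b),\ \Big(md_i(p_i)-\frac{q_i(b)}{a(I-1)}\Big)q_i(b)\right\}\quad\text{s.t.}\quad \sum_k p_i^k+q_i(b)=D_i.$$ A bid profile $b^*$, with corresponding optimal adjustment $p^*$ (for each $i$, $p_i^*$ minimizes $\Gamma_i$ over $p_i$ at the bids $b^*$ subject to the constraint), is a generalized Nash equilibrium (GNE) if for every $i$, $(p_i^*,b_i^* )$ is an optimal solution of prosumer $i$'s problem given $b_{-i}^*$. At the equilibrium, $\lambda_i^{c*}$ is $\lambda_i^c$ evaluated at $\lambda_i=\lambda_i(b^* )$, $q_i=q_i(b^* )$, $md_i=md_i(p_i^* )$. Program (P) and its dual variables. $$\min_{p\in\mathbb{R}^{I\times K}}\ \sum_{i}\sum_{k} c_i^k(p_i^k)^2+\sum_i\frac{\left(D_i-\sum_k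 p_i^k\right)^2}{2a(I-1)}$$ $$\text{s.t.}\quad \sum_i\sum_k p_i^k=\sum_i D_i\ :\kappa,\qquad -F_l\le\sum_i\pi_{il}\Big(D_i-\sum_k p_i^k\Big)\le F_l\ :\tau_l^-,\tau_l^+\ \ \forall l,$$ with the sign convention that the KKT conditions read, for all $i,k,l$, $$2c_i^kp_i^k+\frac{\sum_k p_i^k-D_i}{a(I-1)}+\kappa+\sum_l\pi_{il}\tau_l^--\sum_l\pi_{il}\tau_l^+=0,$$ $$\sum_i\sum_k p_i^k=\sum_i D_i,\quad 0\le\Big(\sum_i\pi_{il}(D_i-\sum_k p_i^k)+F_l\Big)\perp\tau_l^-\ge0,\quad 0\le\Big(-\sum_i\pi_{il}(D_i-\sum_k p_i^k)+F_l\Big)\perp\tau_l^+\ge0.$$ $\kappa^*,\tau_l^{*\pm}$ are multipliers satisfying these conditions at the optimal solution of (P).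
   Formalization: The generalized Nash equilibrium is assumed to be unique (as a bid profile); under congestion there can be several equilibria, and the price formula fails for some of them, e.g. I=2, K=1, c=a=1, F=1, D=(3,-3), b=(1,-1). *)

(* Defs.v *)
From mathcomp Require Import all_boot all_order all_algebra.
From mathcomp Require Import classical_sets reals.

Set Implicit Arguments.
Unset Strict Implicit.
Unset Printing Implicit Defensive.

Import Order.TTheory GRing.Theory Num.Theory.
Local Open Scope classical_set_scope.
Local Open Scope ring_scope.

Definition is_minimizer (R : realType) (T : Type) (X : set T) (f : T -> R)
    (x : T) : Prop :=
  X x /\ forall y, X y -> f x <= f y.

(* The undirected line [l] joins [src l] and [dst l]; the order of its two
   endpoints only fixes which direction of flow is counted as positive. *)
Record network (R : realType) (nI nL : nat) := Network {
  bus : finType;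
  loc : 'I_nI -> bus;
  src : 'I_nL -> bus;
  dst : 'I_nL -> bus;
  reactance : 'I_nL -> R;
  no_loop : forall l, src l != dst l;
  no_parallel : injective (fun l => [set src l; dst l]%SET);
  reactance_gt0 : forall l, 0 < reactance l
}.

Section DCPowerFlow.
Variables (R : realType) (nI nL : nat) (N : network R nI nL).

(* [f] is the DC flow caused by the transactions [q]: for some phase angles
   [theta], Ohm's law holds on every line and the net injection of every bus
   equals its net outflow. *)
Definition dc_flow (q : 'rV[R]_nI) (f : 'rV[R]_nL) : Prop :=
  exists theta : bus N -> R,
    (forall l, f 0 l = (theta (src N l) - theta (dst N l)) / reactance N l) /\
    (forall n, \sum_(i | loc N i == n) q 0 i =
       \sum_(l | src N l == n) f 0 l - \sum_(l | dst N l == n) f 0 l).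

Definition is_distribution_factor (ptdf : 'M[R]_(nI, nL)) : Prop :=
  forall q : 'rV[R]_nI, \sum_i q 0 i = 0 -> dc_flow q (q *m ptdf).

End DCPowerFlow.

Record market (R : realType) (nI nK nL : nat) := Market {
  demand : 'rV[R]_nI;
  cost : 'M[R]_(nI, nK);
  sens : R;
  limit : 'rV[R]_nL;
  ptdf : 'M[R]_(nI, nL)
}.

Section SharingGame.
Variables (R : realType) (nI nK nL : nat) (M : market R nI nK nL).

Let D := demand M.
Let c := cost M.
Let a := sens M.
Let F := limit M.

Definition flow (q : 'rV[R]_nI) (l : 'I_nL) : R :=
  \sum_i ptdf M i l * q 0 i.

Definition within_limits (q : 'rV[R]_nI) : Prop :=
  forall l, - F 0 l <= flow q l <= F 0 l.

Definition clearing_feasible (b lam : 'rV[R]_nI) : Prop :=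
  \sum_i (- a * lam 0 i + b 0 i) = 0 /\ within_limits (- a *: lam + b).

Definition clearing_objective (lam : 'rV[R]_nI) : R :=
  nI%:R^-1 * \sum_i lam 0 i ^+ 2.

Definition is_clearing_price (price : 'rV[R]_nI -> 'rV[R]_nI) : Prop :=
  forall b, is_minimizer (clearing_feasible b) clearing_objective (price b).

Definition marginal_disutility (i : 'I_nI) (pi : 'rV[R]_nK) : R :=
  2 * (\sum_k pi 0 k) / \sum_k (c i k)^-1.

Definition adjusted_marginal (i : 'I_nI) (pi : 'rV[R]_nK) (qi : R) : R :=
  marginal_disutility i pi - qi / (a * (nI%:R - 1)).

Variable price : 'rV[R]_nI -> 'rV[R]_nI.

Definition transaction (b : 'rV[R]_nI) (i : 'I_nI) : R :=
  - a * price b 0 i + b 0 i.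

Definition regulated_price (b : 'rV[R]_nI) (p : 'M[R]_(nI, nK))
    (i : 'I_nI) : R :=
  let qi := transaction b i in
  let mi := adjusted_marginal i (row i p) qi in
  if 0 <= qi then Num.max (price b 0 i) mi else Num.min (price b 0 i) mi.

Definition Gamma (i : 'I_nI) (pi : 'rV[R]_nK) (b : 'rV[R]_nI) : R :=
  let qi := transaction b i in
  \sum_k c i k * pi 0 k ^+ 2 +
  Num.max (price b 0 i * qi) (adjusted_marginal i pi qi * qi).

Definition adjustment_feasible (i : 'I_nI) (pi : 'rV[R]_nK)
    (b : 'rV[R]_nI) : Prop :=
  \sum_k pi 0 k + transaction b i = D 0 i.

Definition set_bid (b : 'rV[R]_nI) (i : 'I_nI) (x : R) : 'rV[R]_nI :=
  \row_j if j == i then x else b 0 j.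

Definition optimal_adjustment (b : 'rV[R]_nI) (p : 'M[R]_(nI, nK)) : Prop :=
  forall i, is_minimizer [set pi | adjustment_feasible i pi b]
    (fun pi => Gamma i pi b) (row i p).

Definition is_GNE (b : 'rV[R]_nI) (p : 'M[R]_(nI, nK)) : Prop :=
  optimal_adjustment b p /\
  forall i, is_minimizer
    [set s : 'rV[R]_nK * R | adjustment_feasible i s.1 (set_bid b i s.2)]
    (fun s => Gamma i s.1 (set_bid b i s.2)) (row i p, b 0 i).

End SharingGame.

Section SocialProgram.
Variables (R : realType) (nI nK nL : nat) (M : market R nI nK nL).

Let D := demand M.
Let c := cost M.
Let a := sens M.
Let F := limit M.

Definition imbalance (p : 'M[R]_(nI, nK)) : 'rV[R]_nI :=
  \row_i (D 0 i - \sum_k p i k).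

Definition program_feasible (p : 'M[R]_(nI, nK)) : Prop :=
  \sum_i \sum_k p i k = \sum_i D 0 i /\ within_limits M (imbalance p).

Definition program_objective (p : 'M[R]_(nI, nK)) : R :=
  \sum_i \sum_k c i k * p i k ^+ 2 +
  \sum_i (D 0 i - \sum_k p i k) ^+ 2 / (2 * a * (nI%:R - 1)).

Definition program_optimal (p : 'M[R]_(nI, nK)) : Prop :=
  is_minimizer program_feasible program_objective p.

Definition complementary (x y : R) : Prop := [/\ 0 <= x, 0 <= y & x * y = 0].

Definition KKT (p : 'M[R]_(nI, nK)) (kappa : R) (taum taup : 'rV[R]_nL)
    : Prop :=
  [/\ forall i k,
        2 * c i k * p i k + (\sum_j p i j - D 0 i) / (a * (nI%:R - 1)) + kappa
        + \sum_l ptdf M i l * taum 0 l - \sum_l ptdf M i l * taup 0 l = 0,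
      \sum_i \sum_k p i k = \sum_i D 0 i,
      forall l, complementary (flow M (imbalance p) l + F 0 l) (taum 0 l)
    & forall l, complementary (- flow M (imbalance p) l + F 0 l) (taup 0 l)].

End SocialProgram.

(* Main.v *)
Require Import Defs.
From mathcomp Require Import all_boot all_order all_algebra.
From mathcomp Require Import classical_sets reals.
From mathcomp Require Import ring lra.

Set Implicit Arguments.
Unset Strict Implicit.
Unset Printing Implicit Defensive.

Import Order.TTheory GRing.Theory Num.Theory.
Local Open Scope ring_scope.

(** The equilibrium is identified by exhibiting one.  Put
    lambda_i = - kappa - sum_l pi_il tau-_l + sum_l pi_il tau+_l and let q be
    the transactions D_i - sum_k p_i^k at the optimum of the program.
    Stationarity says 2 c_i^k p_i^k = lambda_i + q_i / (a (I - 1)), so the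
    adjusted marginal disutility of each prosumer is exactly lambda_i.  We show
    that the bids b_i = q_i + a lambda_i form a GNE with clearing price lambda;
    uniqueness of the equilibrium then transfers the price formula to the given
    b.  The marginal disutility depends on p_i only through sum_k p_i^k, which
    the bids determine, so at b both arguments of the max or min defining the
    regulated price equal lambda_i, whatever the sign of q_i.

    In terms of transactions, the feasible set of the clearing problem does not
    depend on the bids, and a price vector clears the market exactly when
    sum_i lambda_i (q_i - r_i) >= 0 for every admissible r.  Necessity is
    [price_variational]; [variational_price_unique] shows that the inequality
    determines the price; [KKT_variational] derives it for lambda from
    complementary slackness.  Hence lambda is the clearing price at the bids
    above ([KKT_clears]).

    For the equilibrium property, let prosumer i alone change its bid.  Adding
    the variational inequalities at both bids, and using Cauchy-Schwarz over the
    other prosumers, gives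
    dlambda_i * dq_i >= dq_i ^ 2 / (a (I - 1)) ([deviation_slope]): the price
    rises with the own transaction at least as steeply as in the absence of
    network constraints.  Then [deviation_cost] finishes, by one of the two
    terms of the maximum in the cost: moving q_i towards zero, without passing
    it, is penalised by the regulated term, while moving it away from zero or
    past zero is penalised by the market term because of the slope. *)

(** * Sums of squares *)

(** Cauchy-Schwarz, from the nonnegativity of the weighted variance
    [\sum_i w i * (x i - t / w i) ^+ 2] at [t = (\sum x) / (\sum w^-1)]. *)
Lemma sqr_sum_le_weighted (R : realFieldType) (T : finType) (P : pred T)
    (w x : T -> R) :
  (forall i, P i -> 0 < w i) -> 0 < \sum_(i | P i) (w i)^-1 ->
  (\sum_(i | P i) x i) ^+ 2 / (\sum_(i | P i) (w i)^-1)
    <= \sum_(i | P i) w i * x i ^+ 2.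
Proof.
move=> w_gt0; set S := \sum_(i | P i) x i; set C := \sum_(i | P i) _ => C_gt0.
have var_ge0 : 0 <= \sum_(i | P i) w i * (x i - S / C * (w i)^-1) ^+ 2.
  by apply: sumr_ge0 => i /w_gt0 wi; rewrite mulr_ge0 ?sqr_ge0 ?ltW.
rewrite -subr_ge0; apply: le_trans var_ge0 _.
rewrite (eq_bigr (fun i => w i * x i ^+ 2 - 2 * (S / C) * x i
                           + (S / C) ^+ 2 * (w i)^-1)); last first.
  by move=> i /w_gt0 wi; field; rewrite !gt_eqF.
rewrite big_split sumrB -!mulr_sumr -/S -/C /=.
by rewrite le_eqVlt; apply/orP; left; apply/eqP; field; rewrite gt_eqF.
Qed.

(** Expanding [norm (u + t d) ^ 2 >= norm u ^ 2] for small [t] leaves the sign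
    of the inner product, here denoted [s]. *)
Lemma ge0_of_quadratic (R : realFieldType) (s n : R) :
  0 <= n -> (forall t : R, 0 <= t <= 1 -> 0 <= 2 * t * s + t ^+ 2 * n) -> 0 <= s.
Proof.
move=> n_ge0 quad; rewrite leNgt; apply/negP => s_lt0.
have d_gt0 : 0 < n - s by lra.
(* The quadratic is least at [- s / n]; the extra [- s] in the denominator
   keeps the point within [0, 1] and covers [n = 0]. *)
have t_in : 0 <= - s / (n - s) <= 1.
  apply/andP; split; first by apply: divr_ge0; lra.
  by rewrite ler_pdivrMr // mul1r; lra.
have := quad _ t_in.
have -> : 2 * (- s / (n - s)) * s + (- s / (n - s)) ^+ 2 * n
          = s ^+ 2 * (2 * s - n) / (n - s) ^+ 2.
  by field; rewrite gt_eqF.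
rewrite leNgt pmulr_llt0 ?invr_gt0 ?exprn_gt0 //.
have s2_gt0 : 0 < s ^+ 2 by rewrite exprn_even_gt0 //= lt_eqF.
by rewrite pmulr_rlt0 //; lra.
Qed.

(** * Market clearing as a variational inequality *)

Definition admissible {R : realType} {nI nK nL : nat} (M : market R nI nK nL)
    (q : 'rV[R]_nI) : Prop :=
  \sum_i q 0 i = 0 /\ within_limits M q.

Definition trade {R : realType} {nI nK nL : nat} (M : market R nI nK nL)
    (b lam : 'rV[R]_nI) : 'rV[R]_nI := - sens M *: lam + b.

(** First-order optimality of the price vector [lam] for the transactions [q],
    written in terms of transactions. *)
Definition variational {R : realType} {nI nK nL : nat} (M : market R nI nK nL)
    (lam q : 'rV[R]_nI) : Prop :=
  forall r, admissible M r -> 0 <= \sum_i lam 0 i * (q 0 i - r 0 i).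

Section Clearing.
Variables (R : realType) (nI nK nL : nat) (M : market R nI nK nL).
Hypothesis a_gt0 : 0 < sens M.

Lemma tradeE b lam i : trade M b lam 0 i = - sens M * lam 0 i + b 0 i.
Proof. by rewrite !mxE. Qed.

Lemma clearing_feasibleE b lam :
  clearing_feasible M b lam <-> admissible M (trade M b lam).
Proof.
by rewrite /clearing_feasible /admissible -(eq_bigr _ (fun i _ => tradeE b lam i)).
Qed.

Lemma admissible_convex t q r : 0 <= t <= 1 ->
  admissible M q -> admissible M r -> admissible M ((1 - t) *: q + t *: r).
Proof.
move=> /andP[t_ge0 t_le1] [q_sum q_lim] [r_sum r_lim]; split.
  rewrite (eq_bigr (fun i => (1 - t) * q 0 i + t * r 0 i)); last first.
    by move=> i _; rewrite !mxE.
  by rewrite big_split -!mulr_sumr /= q_sum r_sum !mulr0 addr0.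
move=> l.
have -> : flow M ((1 - t) *: q + t *: r) l
          = (1 - t) * flow M q l + t * flow M r l.
  rewrite /flow !mulr_sumr -big_split; apply: eq_bigr => i _ /=.
  by rewrite !mxE; ring.
have /andP[] := q_lim l; have /andP[] := r_lim l.
by move=> *; apply/andP; split; nra.
Qed.

Variable price : 'rV[R]_nI -> 'rV[R]_nI.
Hypothesis price_clears : is_clearing_price M price.

Lemma price_admissible b : admissible M (trade M b (price b)).
Proof. by apply/clearing_feasibleE; case: (price_clears b). Qed.

Lemma price_variational b : variational M (price b) (trade M b (price b)).
Proof.
move=> r r_adm; have [_ min_price] := price_clears b.
set lam := price b in min_price *.
pose dir i := trade M b lam 0 i - r 0 i.
have n_ge0 : 0 <= (sens M)^-1 * \sum_i dir i ^+ 2.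
  by rewrite mulr_ge0 ?sumr_ge0 ?invr_ge0 ?(ltW a_gt0) // => i _; rewrite sqr_ge0.
apply: (ge0_of_quadratic n_ge0) => t t_in.
(* The price at which the transactions are the convex combination of the
   cleared ones and [r]. *)
pose lamt : 'rV[R]_nI := \row_i (lam 0 i + t / sens M * dir i).
have trade_lamt : trade M b lamt = (1 - t) *: trade M b lam + t *: r.
  apply/rowP => i; rewrite tradeE !mxE /dir tradeE.
  by field; rewrite gt_eqF.
have lamt_feasible : clearing_feasible M b lamt.
  apply/clearing_feasibleE; rewrite trade_lamt.
  exact: admissible_convex (price_admissible b) r_adm.
have := min_price _ lamt_feasible; rewrite /clearing_objective.
have [nI0|nI_gt0] := posnP nI.
  move=> _; rewrite !big1 ?mulr0 ?addr0 // => -[i lt_i] *;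
    by exfalso; rewrite nI0 in lt_i.
rewrite ler_pM2l ?invr_gt0 ?ltr0n // -subr_ge0 => diff_ge0.
have a_neq0 : sens M != 0 by rewrite gt_eqF.
rewrite -(pmulr_rge0 _ (_ : 0 < (sens M)^-1)) ?invr_gt0 //.
apply: le_trans diff_ge0 _; rewrite le_eqVlt; apply/orP; left; apply/eqP.
rewrite -sumrB !mulr_sumr -big_split mulr_sumr; apply: eq_bigr => i _ /=.
by rewrite mxE -/(dir i); field.
Qed.

(** Adding the inequalities of two solutions gives
    [- a * \sum_i (lam i - price i) ^ 2 >= 0]. *)
Lemma variational_price_unique b lam :
  admissible M (trade M b lam) -> variational M lam (trade M b lam) ->
  price b = lam.
Proof.
move=> lam_adm lam_var.
have := lam_var _ (price_admissible b); have := @price_variational b _ lam_adm.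
move=> /addr_ge0/[apply]; rewrite -big_split /=.
rewrite (eq_bigr (fun i => - sens M * (price b 0 i - lam 0 i) ^+ 2)); last first.
  by move=> i _; rewrite !tradeE; ring.
rewrite -mulr_sumr mulNr oppr_ge0 pmulr_rle0 // => sum_le0.
have sqr_ge0' (i : 'I_nI) : true -> 0 <= (price b 0 i - lam 0 i) ^+ 2.
  by rewrite sqr_ge0.
have /eqP : \sum_i (price b 0 i - lam 0 i) ^+ 2 = 0.
  by apply/eqP; rewrite eq_le sum_le0 sumr_ge0.
rewrite psumr_eq0 // => /allP all0; apply/rowP => i; apply/eqP.
have := all0 i (mem_index_enum i).
by rewrite /= sqrf_eq0 subr_eq0.
Qed.

(** The two variational inequalities add up to
    [\sum_j dlam j * dq j >= 0]; every [j != i] keeps its bid, so contributes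
    [- dq j ^ 2 / a], and [\sum_(j != i) dq j = - dq i]. *)
Lemma deviation_slope (hI : (2 <= nI)%N) (b b' : 'rV[R]_nI) i :
  (forall j, j != i -> b' 0 j = b 0 j) ->
  (transaction M price b' i - transaction M price b i) ^+ 2
      / (sens M * (nI%:R - 1))
    <= (price b' 0 i - price b 0 i)
       * (transaction M price b' i - transaction M price b i).
Proof.
move=> same_bid; rewrite /transaction -!tradeE.
set q := trade M b _; set q' := trade M b' _.
have [q_adm q'_adm] := (price_admissible b, price_admissible b').
have := @price_variational b _ q'_adm; have := @price_variational b' _ q_adm.
rewrite -/q -/q' => /addr_ge0/[apply]; rewrite -big_split /=.
rewrite (bigD1 i) //=.
rewrite (eq_bigr (fun j => - ((sens M)^-1 * (1 * (q' 0 j - q 0 j) ^+ 2))));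
    last first.
  move=> j /same_bid bj; rewrite !tradeE bj.
  by field; rewrite gt_eqF.
rewrite sumrN -mulr_sumr subr_ge0 => slope.
have m_gt0 : 0 < nI%:R - 1 :> R by rewrite subr_gt0 ltr1n.
have card_others : \sum_(j | j != i) (1 : R)^-1 = nI%:R - 1.
  rewrite invr1 sumr_const cardC1 card_ord -subn1 natrB //.
  exact: ltnW.
have sum_others : \sum_(j | j != i) (q' 0 j - q 0 j) = - (q' 0 i - q 0 i).
  case: q_adm q'_adm => [q_sum _] [q'_sum _].
  have : \sum_j (q' 0 j - q 0 j) = 0 by rewrite sumrB q_sum q'_sum subr0.
  by rewrite (bigD1 i) //= addrC => /eqP; rewrite addr_eq0 => /eqP.
have := @sqr_sum_le_weighted R _ (fun j => j != i) (fun=> 1)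
  (fun j => q' 0 j - q 0 j) (fun _ _ => ltr01).
rewrite card_others sum_others sqrrN => /(_ m_gt0) cauchy.
rewrite invfM mulrCA.
apply: le_trans (ler_wpM2l _ cauchy) _; first by rewrite invr_ge0 ltW.
by apply: le_trans slope _; rewrite le_eqVlt; apply/orP; left; apply/eqP; ring.
Qed.

End Clearing.

(** * Optimality of the response of a single prosumer *)

(** [(D - q) ^ 2 / C] is the least disutility of adjusting by [D - q], with
    [C = \sum_k (c k)^-1], and [g = a (I - 1)].  Along the regulated term the
    total cost is [D ^ 2 / C - q ^ 2 (1 / C + 1 / g)], which is at least its
    value at [q0] when [q] lies between [0] and [q0].  Otherwise [q] and [q - q0]
    have the same sign, so the slope bound turns into a lower bound of the
    market term, and the increment is at least [(q - q0) ^ 2 / g]. *)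
Lemma deviation_cost (R : realFieldType) (C g D q0 lam0 q lam : R) :
  0 < C -> 0 < g -> lam0 = 2 * (D - q0) / C - q0 / g ->
  (q - q0) ^+ 2 / g <= (lam - lam0) * (q - q0) ->
  (D - q0) ^+ 2 / C + lam0 * q0
    <= (D - q) ^+ 2 / C + Num.max (lam * q) ((2 * (D - q) / C - q / g) * q).
Proof.
rewrite -invr_gt0 -(invr_gt0 g) => C_gt0 g_gt0.
move: C^-1 g^-1 C_gt0 g_gt0 => u v u_gt0 v_gt0 lam0E slope.
have [same_sign|inward] := ltP 0 (q * (q - q0)).
  have d_neq0 : q - q0 != 0 by apply: contraTneq same_sign => ->; rewrite mulr0 ltxx.
  have market : q * (q - q0) * v <= (lam - lam0) * q.
    rewrite -(@ler_pM2r _ ((q - q0) ^+ 2)) ?exprn_even_gt0 //.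
    have := ler_wpM2l (ltW same_sign) slope.
    by congr (_ <= _); ring.
  apply: (@le_trans _ _ ((D - q) ^+ 2 * u + lam * q)); last first.
    by rewrite lerD2l le_max lexx.
  have := mulr_ge0 (sqr_ge0 (q - q0)) (ltW u_gt0).
  have := mulr_ge0 (sqr_ge0 (q - q0)) (ltW v_gt0).
  move: market; rewrite lam0E; nra.
apply: (@le_trans _ _ ((D - q) ^+ 2 * u + (2 * (D - q) * u - q * v) * q)).
  have sqr_le : 0 <= q0 ^+ 2 - q ^+ 2.
    by have := sqr_ge0 (q - q0); nra.
  have := mulr_ge0 sqr_le (ltW u_gt0); have := mulr_ge0 sqr_le (ltW v_gt0).
  rewrite lam0E; nra.
by rewrite lerD2l le_max lexx orbT.
Qed.

(** * The equilibrium built from the program *)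

Definition dual_price {R : realType} {nI nK nL : nat} (M : market R nI nK nL)
    (kappa : R) (taum taup : 'rV[R]_nL) : 'rV[R]_nI :=
  \row_i (- kappa - \sum_l ptdf M i l * taum 0 l
                  + \sum_l ptdf M i l * taup 0 l).

(** The bids at which the price [dual_price] results in the transactions
    [imbalance]. *)
Definition dual_bid {R : realType} {nI nK nL : nat} (M : market R nI nK nL)
    (p : 'M[R]_(nI, nK)) (kappa : R) (taum taup : 'rV[R]_nL) : 'rV[R]_nI :=
  imbalance M p + sens M *: dual_price M kappa taum taup.

Section Equilibrium.
Variables (R : realType) (nI nK nL : nat) (M : market R nI nK nL).
Hypothesis hI : (2 <= nI)%N.
Hypothesis hK : (0 < nK)%N.
Hypothesis a_gt0 : 0 < sens M.
Hypothesis c_gt0 : forall i k, 0 < cost M i k.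
Variables (p : 'M[R]_(nI, nK)) (kappa : R) (taum taup : 'rV[R]_nL).
Hypothesis kkt : KKT M p kappa taum taup.

Local Notation lam := (dual_price M kappa taum taup).
Local Notation bid := (dual_bid M p kappa taum taup).

Lemma sum_inv_cost_gt0 i : 0 < \sum_k (cost M i k)^-1.
Proof.
rewrite (bigD1 (Ordinal hK)) //= ltr_pwDl ?invr_gt0 // sumr_ge0 // => k _.
by rewrite invr_ge0 ltW.
Qed.

Lemma gain_gt0 : 0 < sens M * (nI%:R - 1).
Proof. by rewrite mulr_gt0 // subr_gt0 ltr1n. Qed.

Lemma trade_dual_bid : trade M bid lam = imbalance M p.
Proof. by rewrite /trade /dual_bid scaleNr addrC addrK. Qed.

Lemma imbalance_admissible : admissible M (imbalance M p).
Proof.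
have [_ balance lower upper] := kkt; split.
  rewrite (eq_bigr (fun i => demand M 0 i - \sum_k p i k)) => [|i _].
    by rewrite sumrB balance subrr.
  by rewrite mxE.
move=> l; have [lo _ _] := lower l; have [up _ _] := upper l.
by apply/andP; split; lra.
Qed.

(** Paired with a difference of balanced transactions, [kappa] vanishes, and a
    multiplier is nonzero only on a line where the flow of [imbalance M p] is
    extremal among the admissible ones. *)
Lemma KKT_variational : variational M lam (imbalance M p).
Proof.
have [_ _ lower upper] := kkt; have [q_sum _] := imbalance_admissible.
move=> r [r_sum r_lim]; set q := imbalance M p in q_sum lower upper *.
have pair_tau (tau : 'rV[R]_nL) :
    \sum_i (\sum_l ptdf M i l * tau 0 l) * (q 0 i - r 0 i)
    = \sum_l tau 0 l * (flow M q l - flow M r l).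
  rewrite (eq_bigr (fun i => \sum_l ptdf M i l * tau 0 l * (q 0 i - r 0 i)));
    last by move=> i _; rewrite mulr_suml.
  rewrite exchange_big; apply: eq_bigr => l _ /=.
  rewrite /flow -sumrB mulr_sumr; apply: eq_bigr => i _; ring.
rewrite (eq_bigr (fun i => - kappa * (q 0 i - r 0 i)
    - (\sum_l ptdf M i l * taum 0 l) * (q 0 i - r 0 i)
    + (\sum_l ptdf M i l * taup 0 l) * (q 0 i - r 0 i))); last first.
  by move=> i _; rewrite mxE; ring.
rewrite big_split sumrB /= -mulr_sumr sumrB q_sum r_sum subrr mulr0 sub0r.
rewrite !pair_tau -sumrN -big_split /=; apply: sumr_ge0 => l _.
have [_ tm_ge0 tm_slack] := lower l; have [_ tp_ge0 tp_slack] := upper l.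
have /andP[lo up] := r_lim l.
have := mulr_ge0 tm_ge0 (_ : 0 <= flow M r l + limit M 0 l).
have := mulr_ge0 tp_ge0 (_ : 0 <= limit M 0 l - flow M r l).
move=> /(_ ltac:(lra)) hp /(_ ltac:(lra)) hm; nra.
Qed.

Lemma stationarity i k :
  2 * cost M i k * p i k
  = lam 0 i + imbalance M p 0 i / (sens M * (nI%:R - 1)).
Proof.
by have [stat _ _ _] := kkt; have := stat i k; rewrite !mxE; lra.
Qed.

(** Summing [stationarity] divided by [cost M i k] over [k]. *)
Lemma dual_price_adjusted_marginal i :
  lam 0 i = 2 * (demand M 0 i - imbalance M p 0 i) / (\sum_k (cost M i k)^-1)
            - imbalance M p 0 i / (sens M * (nI%:R - 1)).
Proof.
have C_gt0 := sum_inv_cost_gt0 i.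
set x := imbalance M p 0 i / _.
have -> : demand M 0 i - imbalance M p 0 i = \sum_k p i k by rewrite mxE; ring.
rewrite mulr_sumr (eq_bigr (fun k => (lam 0 i + x) * (cost M i k)^-1)).
  by rewrite -mulr_sumr mulfK ?gt_eqF // addrK.
by move=> k _; rewrite -(stationarity i k); field; rewrite gt_eqF.
Qed.

(** [p i] equalises the marginal costs, so it attains equality in
    [sqr_sum_le_weighted]. *)
Lemma disutility_at_optimum i :
  \sum_k cost M i k * p i k ^+ 2
  = (demand M 0 i - imbalance M p 0 i) ^+ 2 / (\sum_k (cost M i k)^-1).
Proof.
have C_gt0 := sum_inv_cost_gt0 i.
have lamE := dual_price_adjusted_marginal i; have stat := stationarity i.
set C := \sum_k _ in C_gt0 lamE *; set x := imbalance M p 0 i / _ in lamE stat.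
set S := demand M 0 i - _ in lamE *.
have SE : S = \sum_k p i k by rewrite /S mxE; ring.
rewrite (eq_bigr (fun k => S / C * p i k)).
  by rewrite -mulr_sumr -SE; ring.
move=> k _; have := stat k; rewrite lamE subrK => ck.
have {}ck : cost M i k * p i k = S / C by lra.
by rewrite expr2 mulrA ck.
Qed.

Variable price : 'rV[R]_nI -> 'rV[R]_nI.
Hypothesis price_clears : is_clearing_price M price.

Lemma KKT_clears : price bid = lam.
Proof.
apply: (variational_price_unique a_gt0 price_clears); rewrite trade_dual_bid.
  exact: imbalance_admissible.
exact: KKT_variational.
Qed.

Lemma transaction_dual_bid i : transaction M price bid i = imbalance M p 0 i.
Proof. by rewrite /transaction KKT_clears -tradeE trade_dual_bid. Qed.

(** The marginal disutility sees [pi] only through its sum. *)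
Lemma adjusted_marginal_feasible i (pi : 'rV[R]_nK) b :
  adjustment_feasible M price i pi b ->
  adjusted_marginal M i pi (transaction M price b i)
  = 2 * (demand M 0 i - transaction M price b i) / (\sum_k (cost M i k)^-1)
    - transaction M price b i / (sens M * (nI%:R - 1)).
Proof.
by rewrite /adjusted_marginal /marginal_disutility => <-; rewrite addrK.
Qed.

Lemma adjusted_marginal_dual_bid i (pi : 'rV[R]_nK) :
  adjustment_feasible M price i pi bid ->
  adjusted_marginal M i pi (transaction M price bid i) = lam 0 i.
Proof.
move=> /adjusted_marginal_feasible->.
by rewrite transaction_dual_bid -dual_price_adjusted_marginal.
Qed.

Lemma adjustment_feasible_dual_bid i :
  adjustment_feasible M price i (row i p) bid.
Proof.
rewrite /adjustment_feasible transaction_dual_bid mxE.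
by rewrite (eq_bigr (p i)) => [|k _]; rewrite ?mxE //; ring.
Qed.

Lemma Gamma_dual_bid i :
  Gamma M price i (row i p) bid
  = (demand M 0 i - imbalance M p 0 i) ^+ 2 / (\sum_k (cost M i k)^-1)
    + lam 0 i * imbalance M p 0 i.
Proof.
rewrite /Gamma (adjusted_marginal_dual_bid (adjustment_feasible_dual_bid i)).
rewrite KKT_clears transaction_dual_bid maxxx -disutility_at_optimum.
by congr (_ + _); apply: eq_bigr => k _; rewrite mxE.
Qed.

Lemma Gamma_deviation i (pi : 'rV[R]_nK) x :
  adjustment_feasible M price i pi (set_bid bid i x) ->
  Gamma M price i (row i p) bid <= Gamma M price i pi (set_bid bid i x).
Proof.
move=> pi_feasible; rewrite Gamma_dual_bid /Gamma.
rewrite (adjusted_marginal_feasible pi_feasible).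
have others j : j != i -> set_bid bid i x 0 j = bid 0 j.
  by rewrite mxE => /negbTE->.
have := deviation_slope a_gt0 price_clears hI others.
rewrite KKT_clears transaction_dual_bid.
set b' := set_bid bid i x in pi_feasible *.
set q := transaction M price b' i in pi_feasible * => slope.
apply: le_trans (deviation_cost (sum_inv_cost_gt0 i) gain_gt0
  (dual_price_adjusted_marginal i) slope) _.
rewrite lerD2r.
have <- : \sum_k pi 0 k = demand M 0 i - q by rewrite -pi_feasible addrK.
exact: sqr_sum_le_weighted (fun k _ => c_gt0 i k) (sum_inv_cost_gt0 i).
Qed.

Lemma set_bid_id (b : 'rV[R]_nI) i : set_bid b i (b 0 i) = b.
Proof. by apply/rowP => j; rewrite mxE; case: eqP => [->|]. Qed.

Lemma dual_bid_GNE : is_GNE M price bid p.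
Proof.
split=> i; split=> /=.
- exact: adjustment_feasible_dual_bid.
- move=> pi; rewrite /= -{1 3}(set_bid_id bid i); exact: Gamma_deviation.
- rewrite set_bid_id; exact: adjustment_feasible_dual_bid.
- by move=> [pi x] /=; rewrite set_bid_id; apply: Gamma_deviation.
Qed.

End Equilibrium.

Theorem proposition5 (R : realType) (nI nK nL : nat)
    (hI : (2 <= nI)%N) (hK : (0 < nK)%N)
    (N : network R nI nL) (M : market R nI nK nL)
    (ha : 0 < sens M)
    (hc : forall i k, 0 < cost M i k)
    (hF : forall l, 0 < limit M 0 l)
    (hptdf : is_distribution_factor N (ptdf M))
    (price : 'rV[R]_nI -> 'rV[R]_nI) (hprice : is_clearing_price M price)
    (b : 'rV[R]_nI) (p : 'M[R]_(nI, nK))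
    (hGNE : is_GNE M price b p)
    (hGNE_unique : forall b' p', is_GNE M price b' p' -> b' = b)
    (pP : 'M[R]_(nI, nK)) (kappa : R) (taum taup : 'rV[R]_nL)
    (hopt : program_optimal M pP) (hKKT : KKT M pP kappa taum taup) :
  forall i : 'I_nI,
    regulated_price M price b p i = price b 0 i /\
    price b 0 i = - kappa - \sum_l ptdf M i l * taum 0 l
                          + \sum_l ptdf M i l * taup 0 l.
Proof.
have bidE : dual_bid M pP kappa taum taup = b.
  exact: hGNE_unique (dual_bid_GNE hI hK ha hc hKKT hprice).
have priceE := KKT_clears ha hKKT hprice.
move=> i; split; last by rewrite -bidE priceE mxE.
have [/(_ i)[p_feasible _] _] := hGNE; rewrite -bidE /= in p_feasible *.
rewrite /regulated_price /=.
rewrite (adjusted_marginal_dual_bid hK ha hc hKKT hprice p_feasible) priceE.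
by rewrite maxxx minxx if_same.
Qed.
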